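(* Let $a_1,\ldots,a_n$ be given distinct real points. Then each isolated equilibrium configuration $z_1,\ldots,z_m$, i.e. each isolated solution $(z_1,\ldots,z_m)$ of the system $$2\sum_{j\neq k}\frac{1}{z_k-z_j}-\sum_{j=1}^n\frac{1}{z_k-a_j}=0,\qquad k=1,\ldots,m,$$ is symmetric with respect to the real line, i.e. the set $\{z_1,\ldots,z_m\}$ is invariant under complex conjugation.
   Context: The unknowns $z_1,\ldots,z_m$ are pairwise distinct points of $\mathbf{C}\setminus\{a_1,\ldots,a_n\}$. The first sum is over $j\in\{1,\ldots,m\}$, $j\ne k$. The system expresses equilibrium of $m$ movable particles of charge $-2$ at the points $z_k$, in the plane with fixed charges $+1$ at the points $a_j$, with force inversely proportional to distance; its solutions are called equilibrium configurations. A solution $(z_1,\ldots,z_m)$ is isolated if it is an isolated point of the set of all solutions of the system (for the given $a_1,\ldots,a_n$ and $m$) in $\mathbf{C}^m$. *)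

(* Defs.v *)
From HB Require Import structures.
From mathcomp Require Export all_boot all_order all_algebra.
From mathcomp Require Export all_classical all_reals all_analysis.
From mathcomp Require Export complex.
Set Implicit Arguments.
Unset Strict Implicit.
Unset Printing Implicit Defensive.
Export Order.TTheory GRing.Theory Num.Theory.
Export numFieldNormedType.Exports.

Local Open Scope ring_scope.
Local Open Scope complex_scope.
Local Open Scope classical_set_scope.

(* The norm topology is attached to abstract numeric fields only; this makes it
   inferable for the concrete type R[i], hence the product topology for
   'rV[R[i]]_m. *)
HB.instance Definition _ (R : realType) := NormedModule.copy R[i] R[i]^o.

(* The first two clauses make every inverse below the inverse of a nonzero
   number. *)
Definition equilibrium_configurations (R : realType) (n m : nat)
    (a : 'I_n -> R) : set 'rV[R[i]]_m :=
  [set z : 'rV[R[i]]_m |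
    [/\ injective (z ord0),
        forall k j, z ord0 k != (a j)%:C
      & forall k : 'I_m,
          2 * (\sum_(j < m | j != k) (z ord0 k - z ord0 j)^-1)
          - \sum_(j < n) (z ord0 k - (a j)%:C)^-1 = 0]].
Arguments equilibrium_configurations {R n} m a.

(* Main.v *)
Require Import Defs.
From mathcomp Require Import perm ring zify.

(* Put P = prod_k (X - z_k), A = prod_j (X - a_j) and
   c_j = P'(a_j) / P(a_j) = sum_k 1 / (a_j - z_k).  Equilibrium means that P
   solves A P'' - A' P' + C P = 0, where C is the polynomial of degree < n with
   C(a_j) = c_j A'(a_j).

   The numbers c_j are real.  For a set S of indices, let v(S) be the sum over
   the injections f from S to the z's of prod_(s in S) 1 / (a_s - f(s)), so that
   v(empty) = 1.  With H_j = sum_(i <> j) (1 - tau_ij) / (a_j - a_i), where tau_ij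
   acts on functions of S by transposing i and j, equilibrium gives
   c_j v(S) = (H_j v)(S), plus v(S + j) if j is not in S.  The
   restriction of v to the sets of the largest size on which it does not vanish is
   therefore an eigenvector, with eigenvalue c_j, of the real symmetric H_j.  This
   is the Bethe ansatz of the Gaudin model of spin 1/2; keeping all sizes avoids
   the question whether the usual Bethe vector (#|S| = m) is nonzero.

   Hence C is real and the conjugate Q of P solves the same linear equation.  If
   Q <> P, the roots of P + t (Q - P) are, for small t > 0, equilibrium
   configurations near z and distinct from it, so that z is not isolated. *)

Set Implicit Arguments.
Unset Strict Implicit.
Unset Printing Implicit Defensive.

Local Open Scope ring_scope.

(** * Sums over injections: permanents of rectangular matrices *)

(* The sum, over the injections f from the entries of s (assumed distinct) to Z,
   of the products of the w i (f i). *)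
Fixpoint partial_perm {F : comNzRingType} {I : eqType} {K : finType}
    (w : I -> K -> F) (s : seq I) (Z : {set K}) : F :=
  if s is i :: s' then \sum_(k in Z) w i k * partial_perm w s' (Z :\ k) else 1.

Lemma sum_setD1_swap (F : comNzRingType) (K : finType) (Z : {set K})
    (G : K -> K -> F) :
  \sum_(k in Z) \sum_(l in Z :\ k) G k l = \sum_(k in Z) \sum_(l in Z :\ k) G l k.
Proof.
rewrite (exchange_big_dep [in Z]) /= => [|k l _ /setD1P[]//].
apply: eq_bigr => l lZ; apply: eq_bigl => k.
by rewrite !inE lZ andbT eq_sym andbC.
Qed.

(** The recursion splits off only the head of [s]; an entry further inside is reached by exchanging
    the two nested choices of images. *)
Lemma partial_perm_row (F : comNzRingType) (I : eqType) (K : finType)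
    (w : I -> K -> F) (s : seq I) (Z : {set K}) (i : I) : i \in s ->
  partial_perm w s Z =
    \sum_(k in Z) w i k * partial_perm w (rem i s) (Z :\ k).
Proof.
elim: s Z => //= x s IHs Z; have [-> // | x_neq_i] := eqVneq x i.
rewrite inE eq_sym (negPf x_neq_i) /= => i_s.
under eq_bigr => k _ do rewrite IHs // mulr_sumr.
rewrite sum_setD1_swap; apply: eq_bigr => k _.
rewrite mulr_sumr; apply: eq_bigr => l _.
by rewrite mulrCA !finset.setDDl [[set _] :|: _]finset.setUC.
Qed.

(** Either an injection avoids k, or it sends exactly one entry i of [s] to k. *)
Lemma partial_perm_col (F : comNzRingType) (I : eqType) (K : finType)
    (w : I -> K -> F) (s : seq I) (Z : {set K}) (k : K) : uniq s -> k \in Z ->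
  partial_perm w s Z = partial_perm w s (Z :\ k)
    + \sum_(i <- s) w i k * partial_perm w (rem i s) (Z :\ k).
Proof.
elim: s Z => [|x s IHs] Z /=; first by rewrite big_nil addr0.
move=> /andP[x_s s_uniq] kZ.
rewrite (big_setD1 k kZ) /= big_cons eqxx addrCA; congr (_ + _).
rewrite (eq_bigr (fun l => w x l * partial_perm w s (Z :\ k :\ l)
   + \sum_(i <- s) w i k * (w x l * partial_perm w (rem i s) (Z :\ k :\ l)))).
  rewrite big_split /=; congr (_ + _); rewrite exchange_big /= !big_seq.
  apply: eq_bigr => i i_s; rewrite ifN; last by apply: contraNneq x_s => ->.
  by rewrite /= mulr_sumr.
move=> l /setD1P[l_neq_k lZ]; rewrite (IHs (Z :\ l)) //; last first.
  by rewrite !inE eq_sym l_neq_k.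
rewrite mulrDr mulr_sumr !finset.setDDl [[set k] :|: _]finset.setUC; congr (_ + _).
by apply: eq_bigr => i _; rewrite mulrCA.
Qed.

Definition injection_sum (F : comNzRingType) (I K : finType) (w : I -> K -> F)
  (S : {set I}) (Z : {set K}) : F := partial_perm w (enum S) Z.

Lemma injection_sum0 (F : comNzRingType) (I K : finType) (w : I -> K -> F)
  (Z : {set K}) : injection_sum w finset.set0 Z = 1.
Proof. by rewrite /injection_sum enum_set0. Qed.

Lemma rem_enum (I : finType) (S : {set I}) (i : I) :
  rem i (enum S) = enum (S :\ i).
Proof.
rewrite rem_filter ?enum_uniq // /enum_mem -filter_predI.
by apply: eq_filter => j; rewrite !inE.
Qed.

Lemma injection_sum_row (F : comNzRingType) (I K : finType) (w : I -> K -> F)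
    (S : {set I}) (Z : {set K}) (i : I) : i \in S ->
  injection_sum w S Z =
    \sum_(k in Z) w i k * injection_sum w (S :\ i) (Z :\ k).
Proof.
move=> iS; rewrite /injection_sum (partial_perm_row _ _ (i := i)) ?mem_enum //.
by rewrite rem_enum.
Qed.

Lemma injection_sum_col (F : comNzRingType) (I K : finType) (w : I -> K -> F)
    (S : {set I}) (Z : {set K}) (k : K) : k \in Z ->
  injection_sum w S Z = injection_sum w S (Z :\ k)
    + \sum_(i in S) w i k * injection_sum w (S :\ i) (Z :\ k).
Proof.
move=> kZ; rewrite /injection_sum (partial_perm_col _ (enum_uniq _) kZ).
rewrite big_enum /=.
by under [in LHS]eq_bigr => i _ do rewrite rem_enum.
Qed.

(** * The Bethe vector as an eigenvector, and reality of the c_j *)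

Definition equilibrium (F : fieldType) (I K : finType) (a : I -> F)
    (z : K -> F) : Prop :=
  [/\ injective z, forall k j, z k != a j
    & forall k, 2 * (\sum_(l | l != k) (z k - z l)^-1)
                - \sum_j (z k - a j)^-1 = 0].

(** The c_j of the overview; its v is [bethe_vector] below. *)
Definition charge (F : fieldType) (I K : finType) (a : I -> F) (z : K -> F)
  (j : I) : F := \sum_k (a j - z k)^-1.

Definition bethe_vector (F : fieldType) (I K : finType) (a : I -> F)
  (z : K -> F) (S : {set I}) : F :=
  injection_sum (fun i k => (a i - z k)^-1) S [set: K].

Lemma imset_tperm_id (I : finType) (S : {set I}) (i j : I) :
  (i \in S) = (j \in S) -> tperm i j @: S = S.
Proof.
move=> ijS; apply/finset.setP => x; rewrite -{1}(tpermK i j x).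
by rewrite mem_imset; [case: tpermP => [->|->|] | exact: perm_inj].
Qed.

Lemma imset_tperm_mem (I : finType) (S : {set I}) (i j : I) :
  i \in S -> j \notin S -> tperm i j @: S = j |: S :\ i.
Proof.
move=> iS jS; apply/finset.setP => x; rewrite -{1}(tpermK i j x).
rewrite mem_imset; last exact: perm_inj.
rewrite !inE; case: tpermP => [->|->|/eqP xi /eqP xj].
- by rewrite eqxx (negPf jS) orbF; apply/esym/eqP => ij; rewrite -ij iS in jS.
- by rewrite eqxx iS.
- by rewrite (negPf xi) (negPf xj).
Qed.

Lemma bethe_vector_row (F : fieldType) (I K : finType) (a : I -> F)
    (z : K -> F) (S : {set I}) (i : I) : i \in S ->
  bethe_vector a z S = \sum_k (a i - z k)^-1 *
    injection_sum (fun i k => (a i - z k)^-1) (S :\ i) ([set: K] :\ k).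
Proof.
move=> iS; rewrite /bethe_vector (injection_sum_row _ _ iS).
by apply: eq_bigl => k; rewrite inE.
Qed.

(** For each k in [charge], the injections avoiding k extend by sending j to k and yield v(S + j).
    For those sending i to k, partial fractions turn 1 / ((a_j - z_k) (a_i - z_k)) into a difference
    quotient, whose second term has j in place of i. *)
Lemma bethe_vector_raise (F : fieldType) (I K : finType) (a : I -> F)
    (z : K -> F) (S : {set I}) (j : I) :
  injective a -> (forall k i, z k != a i) -> j \notin S ->
  charge a z j * bethe_vector a z S = bethe_vector a z (j |: S)
    + \sum_(i in S) (bethe_vector a z S - bethe_vector a z (tperm i j @: S))
                    / (a j - a i).
Proof.
move=> a_inj za jS; rewrite /charge mulr_suml.
rewrite (bethe_vector_row _ _ (setU11 j S)).
have -> : (j |: S) :\ j = S by rewrite setU1K.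
under eq_bigr => k _ do rewrite /bethe_vector
  (injection_sum_col _ _ (finset.in_setT k)) mulrDr mulr_sumr.
rewrite big_split /= exchange_big /=; congr (_ + _); apply: eq_bigr => i iS.
have ij : i != j by apply: contraNneq jS => <-.
rewrite (bethe_vector_row _ _ iS) (imset_tperm_mem iS jS).
rewrite (bethe_vector_row _ _ (setU11 j _)).
have -> : (j |: S :\ i) :\ j = S :\ i by rewrite setU1K // !inE (negPf jS) andbF.
rewrite -sumrB mulr_suml; apply: eq_bigr => k _.
rewrite mulrA -mulrBl [RHS]mulrAC.
congr (_ * _); field.
by rewrite !subr_eq0 (inj_eq a_inj) eq_sym ij eq_sym za eq_sym za.
Qed.

Lemma sum_antisym_eq0 (F : numFieldType) (K : finType) (Z : {set K})
    (G : K -> K -> F) :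
  (forall k l, k != l -> G k l = - G l k) ->
  \sum_(k in Z) \sum_(l in Z :\ k) G k l = 0.
Proof.
move=> Ganti; set s := (LHS).
suff : - s = s by move=> /eqP; rewrite eqNr => /eqP.
symmetry.
rewrite {1}/s sum_setD1_swap /s -sumrN; apply: eq_bigr => k _.
by rewrite -sumrN; apply: eq_bigr => l /setD1P[lk _]; rewrite Ganti.
Qed.

Lemma bethe_vector_stay (F : numFieldType) (I K : finType) (a : I -> F)
    (z : K -> F) (S : {set I}) (j : I) :
  injective a -> equilibrium a z -> j \in S ->
  charge a z j * bethe_vector a z S =
    \sum_(i | i \notin S)
       (bethe_vector a z S - bethe_vector a z (tperm i j @: S)) / (a j - a i).
Proof.
move=> a_inj [z_inj za z_eq] jS.
pose w i k := (a i - z k)^-1; pose T := S :\ j.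
pose om U Z := injection_sum w U Z.
have az i k : a i - z k != 0 by rewrite subr_eq0 eq_sym za.
have zz k l : k != l -> z k - z l != 0 by rewrite subr_eq0 (inj_eq z_inj).
(* The equilibrium equation at z_k trades the fixed charges outside S for those in S and the movable
   ones. *)
have charge_eq k : - \sum_(i | i \notin S) w i k =
    \sum_(i in T) w i k + w j k + 2 * \sum_(l in [set: K] :\ k) (z k - z l)^-1.
  have -> : \sum_(l in [set: K] :\ k) (z k - z l)^-1
          = \sum_(l | l != k) (z k - z l)^-1.
    by apply: eq_bigl => l; rewrite !inE andbT.
  have -> : \sum_(i in T) w i k + w j k = \sum_(i in S) w i k.
    by rewrite (big_setD1 j jS) addrC.
  move: (z_eq k); rewrite (bigID (fun i => i \in S)) /= => /eqP.
  rewrite subr_eq0 => /eqP ->.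
  have wN (Q : pred I) : \sum_(i | Q i) (z k - a i)^-1 = - \sum_(i | Q i) w i k.
    by rewrite -sumrN; apply: eq_bigr => i _; rewrite /w -invrN opprB.
  by rewrite !wN addrA subrr add0r.
have -> : \sum_(i | i \notin S)
       (bethe_vector a z S - bethe_vector a z (tperm i j @: S)) / (a j - a i)
    = \sum_k w j k * om T ([set: K] :\ k) * - \sum_(i | i \notin S) w i k.
  under [RHS]eq_bigr do rewrite -sumrN mulr_sumr.
  rewrite [RHS]exchange_big /=; apply: eq_bigr => i iS.
  have ij : i != j by apply: contraNneq iS => ->.
  rewrite tpermC (imset_tperm_mem jS iS) (bethe_vector_row _ _ jS).
  rewrite (bethe_vector_row _ _ (setU11 i _)).
  have -> : (i |: S :\ j) :\ i = S :\ j.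
    by rewrite setU1K // !inE (negPf iS) andbF.
  rewrite -sumrB mulr_suml; apply: eq_bigr => k _; rewrite -/(om T _) /w.
  field.
  by rewrite !az subr_eq0 (inj_eq a_inj) eq_sym ij.
rewrite (bethe_vector_row _ _ jS) mulr_sumr; apply/eqP.
rewrite -subr_eq0 -sumrB; apply/eqP.
(* The difference of the two sides becomes a sum over ordered pairs of distinct points; in the last
   term the second point l comes from expanding [om T] along row i. *)
pose G k l := w j k * (w j l - 2 * (z k - z l)^-1) * om T ([set: K] :\ k)
  - \sum_(i in T) w j k * w i k * (w i l * om (T :\ i) ([set: K] :\ k :\ l)).
transitivity (\sum_(k in [set: K]) \sum_(l in [set: K] :\ k) G k l).
  rewrite [RHS](eq_bigl predT) => [|k]; last by rewrite inE.
  apply: eq_bigr => k _; rewrite charge_eq /G sumrB -mulr_suml -mulr_sumr sumrB.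
  rewrite exchange_big /= -mulr_sumr.
  have -> : charge a z j = w j k + \sum_(l in [set: K] :\ k) w j l.
    by rewrite /charge (bigD1 k) //=; congr (_ + _); apply: eq_bigl => l;
      rewrite !inE andbT.
  have -> : \sum_(i in T) \sum_(l in [set: K] :\ k)
        w j k * w i k * (w i l * om (T :\ i) ([set: K] :\ k :\ l))
      = w j k * om T ([set: K] :\ k) * \sum_(i in T) w i k.
    rewrite mulr_sumr; apply: eq_bigr => i iT.
    by rewrite -mulr_sumr -(injection_sum_row _ _ iT) -/(om _ _) mulrAC.
  rewrite -/w -/(om _ _) -/T -[(a j - z k)^-1]/(w j k); ring.
(* Expanding [om T] along columns l and k leaves factors symmetric in k and l. Their coefficients
   are antisymmetric because w i k * w i l = (w i k - w i l) / (z k - z l) for every row i. *)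
apply: sum_antisym_eq0 => k l kl.
have kZ : k \in [set: K] :\ l by rewrite !inE kl.
have lZ : l \in [set: K] :\ k by rewrite !inE eq_sym kl.
rewrite /G /om (injection_sum_col _ _ kZ) (injection_sum_col _ _ lZ) -!/(om _ _).
rewrite !finset.setDDl [[set l] :|: _]finset.setUC.
set Z := _ :\: _; rewrite !mulrDr !mulr_sumr -!addrA -!sumrB opprD -sumrN.
have lk : z l - z k != 0 by rewrite zz // eq_sym.
congr (_ + _); last apply: eq_bigr => i _.
  rewrite -[RHS]mulNr; congr (_ * _); rewrite /w; field.
  by rewrite ?lk !az zz.
rewrite /w; field.
by rewrite ?lk !az zz.
Qed.

(** Once the raising term vanishes, both cases take the form H_j v: a transposition of two indices
    that are both in S or both outside fixes S, so such summands, i = j among them, are zero. *)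
Lemma bethe_vector_eigen (F : numFieldType) (I K : finType) (a : I -> F)
    (z : K -> F) (S : {set I}) (j : I) :
  injective a -> equilibrium a z ->
  (j \notin S -> bethe_vector a z (j |: S) = 0) ->
  charge a z j * bethe_vector a z S =
    \sum_i (bethe_vector a z S - bethe_vector a z (tperm i j @: S))
            / (a j - a i).
Proof.
move=> a_inj z_eq top.
have tperm0 i : (i \in S) = (j \in S) ->
    (bethe_vector a z S - bethe_vector a z (tperm i j @: S)) / (a j - a i) = 0.
  by move=> ijS; rewrite imset_tperm_id // subrr mul0r.
have [jS|jS] := boolP (j \in S).
  rewrite bethe_vector_stay // [RHS](bigID [in S]) /=.
  rewrite [X in _ = X + _]big1 ?add0r // => i iS.
  by rewrite tperm0 // iS jS.
have [_ za _] := z_eq.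
rewrite bethe_vector_raise // top // add0r [RHS](bigID [in S]) /=.
rewrite [X in _ + X]big1 ?addr0 // => i iS.
by rewrite tperm0 // (negPf iS) (negPf jS).
Qed.

(** Rayleigh quotient: with r the largest size on which v does not vanish, c_j times the squared
    norm [N] of v on the sets of size r is the Hermitian product of H_j v with v. *)
Lemma charge_real (C : numClosedFieldType) (I K : finType) (a : I -> C)
    (z : K -> C) (j : I) :
  injective a -> (forall i, a i \is Num.real) -> equilibrium a z ->
  charge a z j \is Num.real.
Proof.
move=> a_inj a_real z_eq; pose v := bethe_vector a z.
have v0 : v finset.set0 != 0 by rewrite /v /bethe_vector injection_sum0 oner_eq0.
have [S0 vS0 S0_max] := @arg_maxnP _ finset.set0 (fun S => v S != 0)
  (fun S => #|S|) v0.
pose r := #|S0|.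
pose N := \sum_(S : {set I} | #|S| == r) v S * (v S)^*.
have N_gt0 : 0 < N.
  rewrite /N (bigD1 S0) //= ltr_pwDl //; first by rewrite mul_conjC_gt0.
  by apply: sumr_ge0 => S _; rewrite mul_conjC_ge0.
suff cN_real : charge a z j * N \is Num.real.
  by rewrite -[charge a z j](mulfK (lt0r_neq0 N_gt0)) rpred_div // gtr0_real.
have -> : charge a z j * N = \sum_i (N - \sum_(S : {set I} | #|S| == r)
    v (tperm i j @: S) * (v S)^*) / (a j - a i).
  rewrite mulr_sumr; under [RHS]eq_bigr do rewrite -sumrB mulr_suml.
  rewrite [RHS]exchange_big /=; apply: eq_bigr => S /eqP Sr.
  rewrite mulrA bethe_vector_eigen //.
    by rewrite mulr_suml; apply: eq_bigr => i _; rewrite mulrAC mulrBl.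
  move=> jS; apply/eqP; have [//|/S0_max] := eqVneq (bethe_vector a z (j |: S)) 0.
  by rewrite /= cardsU1 jS Sr add1n ltnn.
apply: rpred_sum => i _; apply: rpred_div; last exact: rpredB.
apply: rpredB; first exact: gtr0_real.
(* Symmetry of tau_ij: reindexing by this involution exchanges the two factors, so the sum equals
   its conjugate. *)
have tpermKs : involutive (fun S : {set I} => tperm i j @: S).
  move=> S; rewrite -imset_comp -[RHS]imset_id; apply: eq_imset => x /=.
  exact: tpermK.
rewrite CrealE rmorph_sum /= (reindex_inj (inv_inj tpermKs)) /=.
apply/eqP/eq_big => [S|S _]; first by rewrite card_imset //; exact: perm_inj.
by rewrite rmorphM /= conjCK tpermKs mulrC.
Qed.

(** * The second-order differential equation for P *)

Lemma deriv_prod_XsubC (F : fieldType) (K : Type) (r : seq K) (Q : pred K)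
    (z : K -> F) (x : F) : (forall k, Q k -> x != z k) ->
  (\prod_(k <- r | Q k) ('X - (z k)%:P))^`().[x] =
    (\prod_(k <- r | Q k) ('X - (z k)%:P)).[x] * \sum_(k <- r | Q k) (x - z k)^-1.
Proof.
move=> xz; elim: r => [|k r IHr]; first by rewrite !big_nil derivC horner0 mulr0.
rewrite !big_cons; case: ifP => // /xz; rewrite -subr_eq0 => xzk.
rewrite derivM derivXsubC mul1r !hornerE IHr; field.
by [].
Qed.

Lemma prod_XsubC_neq0 (F : idomainType) (K : finType) (Q : pred K) (z : K -> F)
    (x : F) : (forall k, Q k -> x != z k) ->
  (\prod_(k | Q k) ('X - (z k)%:P)).[x] != 0.
Proof.
move=> xz; rewrite horner_prod; apply/prodf_neq0 => k /xz.
by rewrite !hornerE subr_eq0.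
Qed.

Lemma deriv_prod_XsubC_root (F : idomainType) (K : finType) (z : K -> F) (k : K) :
  (\prod_l ('X - (z l)%:P))^`().[z k] =
    (\prod_(l | l != k) ('X - (z l)%:P)).[z k].
Proof.
by rewrite (bigD1 k) //= derivM derivXsubC mul1r !hornerE subrr mul0r addr0.
Qed.

Lemma deriv2_prod_XsubC_root (F : fieldType) (K : finType) (z : K -> F) (k : K) :
  injective z ->
  (\prod_l ('X - (z l)%:P))^`()^`().[z k] =
    (\prod_(l | l != k) ('X - (z l)%:P)).[z k]
      * (2 * \sum_(l | l != k) (z k - z l)^-1).
Proof.
move=> z_inj; rewrite (bigD1 k) //= derivM derivXsubC mul1r derivD derivM.
rewrite derivXsubC mul1r.
rewrite !hornerD hornerM hornerXsubC subrr mul0r addr0 deriv_prod_XsubC => [|l].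
  by ring.
by rewrite (inj_eq z_inj) eq_sym.
Qed.

(** The factor of [p] in the last term is C in Lagrange form, with value c_j A'(a_j) at a_j. The c_j
    are parameters, so that P and its conjugate can be compared as solutions of one equation. *)
Definition heine_stieltjes (F : fieldType) (I : finType) (a c : I -> F)
    (p : {poly F}) : {poly F} :=
  (\prod_j ('X - (a j)%:P)) * p^`()^`() - (\prod_j ('X - (a j)%:P))^`() * p^`()
    + (\sum_j c j *: \prod_(i | i != j) ('X - (a i)%:P)) * p.

Lemma heine_stieltjes_comb (F : fieldType) (I : finType) (a c : I -> F)
    (t : F) (p q : {poly F}) :
  heine_stieltjes a c p = 0 -> heine_stieltjes a c q = 0 ->
  heine_stieltjes a c (p + t *: (q - p)) = 0.
Proof.
move=> p0 q0.
transitivity ((1 - t%:P) * heine_stieltjes a c p + t%:P * heine_stieltjes a c q).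
  rewrite /heine_stieltjes !(derivD, derivB, derivZ, derivN) -!mul_polyC.
  by ring.
by rewrite p0 q0 !mulr0 addr0.
Qed.

(** At z_k the term C P drops out, P' is the product over l != k, and the two sums of the force are
    P'' / P' and A' / A. *)
Lemma heine_stieltjes_at_root (F : fieldType) (I K : finType) (a c : I -> F)
    (z : K -> F) (k : K) : injective z -> (forall k j, z k != a j) ->
  (heine_stieltjes a c (\prod_l ('X - (z l)%:P))).[z k] =
    (\prod_j ('X - (a j)%:P)).[z k]
    * (\prod_(l | l != k) ('X - (z l)%:P)).[z k]
    * (2 * (\sum_(l | l != k) (z k - z l)^-1) - \sum_j (z k - a j)^-1).
Proof.
move=> z_inj za; rewrite /heine_stieltjes hornerD [X in _ + X]hornerM.
have -> : (\prod_l ('X - (z l)%:P)).[z k] = 0.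
  by rewrite (bigD1 k) //= hornerM hornerXsubC subrr mul0r.
rewrite hornerD hornerN !hornerM deriv2_prod_XsubC_root //.
rewrite deriv_prod_XsubC_root deriv_prod_XsubC //; ring.
Qed.

Lemma equilibrium_of_heine_stieltjes (F : fieldType) (I K : finType)
    (a c : I -> F) (z : K -> F) :
  injective z -> (forall k j, z k != a j) ->
  heine_stieltjes a c (\prod_l ('X - (z l)%:P)) = 0 -> equilibrium a z.
Proof.
move=> z_inj za ode; split=> // k.
have /eqP := heine_stieltjes_at_root c k z_inj za.
rewrite ode horner0 eq_sym !mulf_eq0 (negPf (prod_XsubC_neq0 _)) //.
rewrite (negPf (prod_XsubC_neq0 _)) => [/eqP//|l].
by rewrite (inj_eq z_inj) eq_sym.
Qed.

(** The left side has degree less than m + n but vanishes at the m + n distinct points z_k and a_j: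
    at z_k by equilibrium, at a_j because A drops out and c_j P(a_j) = P'(a_j). *)
Lemma heine_stieltjes_of_equilibrium (F : fieldType) (I K : finType)
    (a : I -> F) (z : K -> F) : injective a -> equilibrium a z ->
  heine_stieltjes a (charge a z) (\prod_l ('X - (z l)%:P)) = 0.
Proof.
move=> a_inj [z_inj za z_eq]; apply/eqP; apply: contraTT isT => ode_neq0.
set p := heine_stieltjes _ _ _ in ode_neq0.
pose rs := codom z ++ codom a.
have rs_uniq : uniq rs.
  rewrite cat_uniq !map_inj_uniq // -!enumT !enum_uniq andbT /=.

  apply/hasPn => _ /codomP[j ->]; apply/negP => /codomP[k /eqP].
  by rewrite eq_sym (negPf (za k j)).
have rs_root : all (root p) rs.
  apply/allP => x; rewrite mem_cat => /orP[] /codomP[k ->]; apply/eqP.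
    by rewrite /p heine_stieltjes_at_root // z_eq mulr0.
  rewrite /p /heine_stieltjes !(hornerD, hornerN, hornerM).
  rewrite deriv_prod_XsubC_root deriv_prod_XsubC => [|l _]; last first.
    by rewrite eq_sym.
  have -> : (\prod_j ('X - (a j)%:P)).[a k] = 0.
    by rewrite (bigD1 k) //= hornerM hornerXsubC subrr mul0r.
  have -> : (\sum_j charge a z j *: \prod_(i | i != j) ('X - (a i)%:P)).[a k]
      = charge a z k * (\prod_(i | i != k) ('X - (a i)%:P)).[a k].
    rewrite horner_sum (bigD1 k) //= [X in _ + X]big1 ?addr0 ?hornerZ // => j jk.
    rewrite hornerZ (bigD1 k (P := fun i => i != j)) 1?eq_sym //=.
    by rewrite hornerM hornerXsubC subrr mul0r mulr0.
  by rewrite -/(charge a z k); ring.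
have := max_poly_roots ode_neq0 rs_root rs_uniq.
rewrite size_cat !size_codom ltnNge => /negP[].
have size_prod (L : finType) (f : L -> F) :
    size (\prod_l ('X - (f l)%:P)) = #|L|.+1.
  by rewrite size_prod_XsubC; congr _.+1; rewrite cardT enumT.
have size_der (q : {poly F}) : (size q^`() <= (size q).-1)%N by exact: size_poly.
have size_mul (q r : {poly F}) s t : (size q <= s)%N -> (size r <= t)%N ->
    ((s + t).-1 <= #|K| + #|I|)%N -> (size (q * r)%R <= #|K| + #|I|)%N.
  by move=> qs rt; apply: leq_trans; apply: leq_trans (size_polyMleq _ _) _; lia.
apply: leq_trans (size_polyD _ _) _; rewrite geq_max; apply/andP; split.
  apply: leq_trans (size_polyD _ _) _; rewrite size_polyN geq_max; apply/andP.
  have := size_der (\prod_l ('X - (z l)%:P))^`().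
  have := size_der (\prod_l ('X - (z l)%:P)).
  have := size_der (\prod_j ('X - (a j)%:P)).
  rewrite !size_prod /= => sA' sP' sP''; split.
    apply: (size_mul _ _ #|I|.+1 #|K|.-1); first by rewrite size_prod.
      by apply: leq_trans sP'' _; rewrite -!subn1 leq_sub2r.
    by lia.
  by apply: (size_mul _ _ #|I| #|K|) => //; lia.
apply: (size_mul _ _ #|I| #|K|.+1); last by lia.
  apply: leq_trans (size_sum _ _ _) _; apply/bigmax_leqP => j _.
  apply: leq_trans (size_scale_leq _ _) _.
  have := size_prod _ a; rewrite (bigD1 j) //= size_monicM ?monicXsubC //.
    by rewrite size_XsubC => -[<-].
  exact/monic_neq0/monic_prod_XsubC.
by rewrite size_prod.
Qed.

(** * Perturbation of an equilibrium *)

Lemma fin_pos_lower_bound (F : numFieldType) (T : finType) (f : T -> F) :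
  (forall x, 0 < f x) -> exists2 d, 0 < d & forall x, d <= f x.
Proof.
move=> f_gt0; have V_ge0 x : 0 <= (f x)^-1 by rewrite invr_ge0 ltW.
have s_gt0 : 0 < 1 + \sum_x (f x)^-1 by rewrite ltr_pwDl ?sumr_ge0.
(* The order is only partial, so this replaces a minimum; the summand 1 covers an empty [T]. *)
exists (1 + \sum_x (f x)^-1)^-1 => [|x]; first by rewrite invr_gt0.
rewrite -[leRHS]invrK lef_pV2 ?posrE ?invr_gt0 //.
by rewrite (bigD1 x) //= addrCA lerDl addr_ge0 // sumr_ge0.
Qed.

Lemma conj_prod_XsubC (C : numClosedFieldType) (K : finType) (z : K -> C) :
  map_poly Num.conj (\prod_k ('X - (z k)%:P)) = \prod_k ('X - (z k)^*%:P).
Proof. exact: map_prod_XsubC. Qed.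

Lemma heine_stieltjes_conj (C : numClosedFieldType) (I : finType) (a c : I -> C)
    (p : {poly C}) :
  (forall i, a i \is Num.real) -> (forall i, c i \is Num.real) ->
  heine_stieltjes a c p = 0 -> heine_stieltjes a c (map_poly Num.conj p) = 0.
Proof.
move=> a_real c_real /(congr1 (map_poly Num.conj)); rewrite rmorph0 => <-.
have mapA (Q : pred I) : map_poly Num.conj (\prod_(i | Q i) ('X - (a i)%:P))
    = \prod_(i | Q i) ('X - (a i)%:P).
  rewrite map_prod_XsubC; apply: eq_bigr => i _.
  by congr ('X - _%:P); exact/CrealP.
rewrite /heine_stieltjes rmorphD rmorphB !rmorphM /= -!deriv_map !mapA.
congr (_ + _ * _); rewrite rmorph_sum; apply: eq_bigr => j _.
by rewrite /= map_polyZ mapA; congr (_ *: _); exact/esym/CrealP.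
Qed.

(* As |p(z)| is the product of the distances from z to the roots of p, a monic
   polynomial that is small at z has a root close to z. *)
Lemma monic_root_near (C : numClosedFieldType) (p : {poly C}) (m : nat)
    (x e : C) : p \is monic -> size p = m.+1 -> 0 < e -> `|p.[x]| < e ^+ m ->
  exists2 y, root p y & `|x - y| < e.
Proof.
move=> p_monic; have [rs] := closed_field_poly_normal p.
rewrite (monicP p_monic) scale1r => -> + e_gt0; rewrite size_prod_XsubC => -[<-].
elim: rs => [|y rs IHrs] /=; first by rewrite big_nil hornerE normr1 expr0 ltxx.
rewrite big_cons hornerM hornerXsubC normrM exprS => small.
have [near|far] := real_ltP (normr_real (x - y)) (gtr0_real e_gt0).
  by exists y => //; rewrite rootM root_XsubC eqxx.
have [|w w_root xw] := IHrs; last by exists w => //; rewrite rootM w_root orbT.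
rewrite -(ltr_pM2l e_gt0); apply: le_lt_trans small.
by rewrite ler_wpM2r.
Qed.

Lemma equilibrium_perturbation (C : numClosedFieldType) (I K : finType)
    (a : I -> C) (z : K -> C) (e : C) :
  injective a -> (forall i, a i \is Num.real) -> equilibrium a z -> 0 < e ->
  \prod_k ('X - (z k)^*%:P) != \prod_k ('X - (z k)%:P) ->
  exists w : K -> C,
    [/\ equilibrium a w, (forall k, `|z k - w k| < e) & ~ (w =1 z)].
Proof.
move=> a_inj a_real z_equi e_gt0; set q := \prod_k _; set p := \prod_k _ => qp.
have [z_inj za _] := z_equi; pose c := charge a z.
have p_ode : heine_stieltjes a c p = 0 by exact: heine_stieltjes_of_equilibrium.
have q_ode : heine_stieltjes a c q = 0.
  rewrite /q -conj_prod_XsubC; apply: heine_stieltjes_conj => // j.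
  exact: charge_real.
(* The diagonal pairs get the dummy value 1 to keep the family positive. *)
have [d1 d1_gt0 d1_le] : exists2 d, 0 < d &
    forall x : K * K, d <= if x.1 == x.2 then 1 else `|z x.1 - z x.2|.
  apply: fin_pos_lower_bound => -[k l] /=; case: eqVneq => // kl.
  by rewrite normr_gt0 subr_eq0 (inj_eq z_inj).
have [d2 d2_gt0 d2_le] : exists2 d, 0 < d &
    forall x : K * I, d <= `|z x.1 - a x.2|.
  by apply: fin_pos_lower_bound => -[k j] /=; rewrite normr_gt0 subr_eq0.
(* [option bool] indexes the three bounds: d1 / 2 keeps the new points distinct, d2 keeps them off
   the a_j, and e keeps them near z. *)
have [d d_gt0 d_le] : exists2 d, 0 < d & forall x : option bool,
    d <= if x is Some b then if b then d1 / 2 else d2 else e.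
  by apply: fin_pos_lower_bound => -[[]|] //; rewrite divr_gt0.
have de : d <= e := d_le None.
have dd1 : d <= d1 / 2 := d_le (Some true).
have dd2 : d <= d2 := d_le (Some false).
have [M M_gt0 qM] : exists2 M, 0 < M & forall k, `|q.[z k]| < M.
  exists (1 + \sum_k `|q.[z k]|) => [|k]; first by rewrite ltr_pwDl ?sumr_ge0.
  rewrite (bigD1 k) //= addrCA ltrDl ltr_pwDl // sumr_ge0 //.
(* As p vanishes at z_k, the perturbed polynomial takes there the value t q(z_k), which this t makes
   smaller than d ^+ #|K|, as [monic_root_near] requires. *)
pose t := d ^+ #|K| / M; have t_gt0 : 0 < t by rewrite divr_gt0 ?exprn_gt0.
pose pt := p + t *: (q - p).
have size_prod (f : K -> C) : size (\prod_k ('X - (f k)%:P)) = #|K|.+1.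
  by rewrite size_prod_XsubC; congr _.+1; rewrite cardT enumT.
have p_monic : p \is monic by exact: monic_prod_XsubC.
have q_monic : q \is monic by exact: monic_prod_XsubC.
(* The leading terms of the monic p and q cancel, so the perturbed polynomial stays monic of degree
   #|K|. *)
have size_qp : (size (t *: (q - p)) < size p)%N.
  apply: leq_ltn_trans (size_scale_leq _ _) _; rewrite size_prod ltnS.
  apply/leq_sizeP => i; rewrite leq_eqVlt coefB => /orP[/eqP <-|ltKi].
    move: (monicP p_monic) (monicP q_monic).
    by rewrite /lead_coef !size_prod /= => -> ->; rewrite subrr.
  by rewrite !nth_default ?subrr // size_prod.
have pt_size : size pt = #|K|.+1 by rewrite size_polyDl // size_prod.
have pt_monic : pt \is monic by rewrite monicE lead_coefDl // -monicE.
have pt_small k : `|pt.[z k]| < d ^+ #|K|.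
  have -> : pt.[z k] = t * q.[z k].
    rewrite hornerD hornerZ hornerD hornerN.
    have -> : p.[z k] = 0.
      by rewrite /p (bigD1 k) //= hornerM hornerXsubC subrr mul0r.
    by rewrite subr0 add0r.
  by rewrite normrM gtr0_norm // /t mulrAC ltr_pdivrMr // ltr_pM2l ?exprn_gt0.
have [w w_root zw] : exists2 w : K -> C, forall k, root pt (w k)
    & forall k, `|z k - w k| < d.
  have /all_sig2[w ? ?] : forall k, {y | root pt y & `|z k - y| < d}.
    by move=> k; apply/cid2; exact: monic_root_near (pt_small k).
  by exists w.
have w_inj : injective w.
  move=> k l wkl; apply/eqP; apply: contraT => kl.
  have /le_lt_trans := d1_le (k, l); rewrite /= (negPf kl) => d1_lt.
  suff /d1_lt : `|z k - z l| < d1 by rewrite ltxx.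
  have -> : z k - z l = (z k - w k) - (z l - w l) by rewrite wkl; ring.
  apply: le_lt_trans (ler_normB _ _) _; rewrite [ltRHS]splitr.
  by apply: ltrD; exact: lt_le_trans dd1.
have wa k j : w k != a j.
  apply/eqP => wkj; have := lt_le_trans (zw k) (le_trans dd2 (d2_le (k, j))).
  by rewrite wkj /= ltxx.
have pt_prod : pt = \prod_k ('X - (w k)%:P).
  have := @all_roots_prod_XsubC _ pt (codom w).
  rewrite size_codom (monicP pt_monic) scale1r big_map enumT => ->  //.
    by apply/allP => x /codomP[k ->].
  by rewrite uniq_rootsE map_inj_uniq // enum_uniq.
exists w; split=> [|k|wz].
- apply: (@equilibrium_of_heine_stieltjes _ _ _ _ c) => //.
  by rewrite -pt_prod; exact: heine_stieltjes_comb.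
- exact: lt_le_trans de.
(* If w were z, then t (q - p) would vanish, against t > 0 and q != p. *)
- move/eqP: pt_prod; rewrite (eq_bigr (fun k => 'X - (z k)%:P)) => [|k _].
    rewrite -/p -subr_eq0 addrAC subrr add0r scaler_eq0 gt_eqF //= subr_eq0.
    exact/negP.
  by rewrite wz.
Qed.

(** * From polynomials back to sets of points *)

Lemma root_prod_XsubC_range (F : idomainType) (K : finType) (f : K -> F)
    (x : F) : root (\prod_k ('X - (f k)%:P)) x <-> range f x.
Proof.
rewrite -(big_map f predT (fun y => 'X - y%:P)) root_prod_XsubC.
split=> [/mapP[k _ ->]|[k _ <-]]; first by exists k.
by rewrite map_f // mem_index_enum.
Qed.

Local Open Scope complex_scope.
Local Open Scope classical_set_scope.

Theorem theorem5 (R : realType) (n m : nat) (a : 'I_n -> R)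
    (a_inj : injective a) (z : 'rV[R[i]]_m)
    (z_iso : isolated (equilibrium_configurations m a) z) :
  [set w^* | w in range (z ord0)] = range (z ord0).
Proof.
have [/set_mem z_equi [V /nbhs_ballP[e e_gt0 eV] VE]] := z_iso.
have aC_inj : injective (fun j => (a j)%:C) by move=> i j /complexI /a_inj.
have aC_real j : (a j)%:C \is Num.real by rewrite complex_real.
(* [z_equi] fits because [equilibrium] unfolds to the clauses of [equilibrium_configurations]. *)
have := @equilibrium_perturbation R[i] _ _ (fun j => (a j)%:C) (z ord0) e
  aC_inj aC_real z_equi e_gt0.
(* If q = p, their root sets agree, and these are the conjugates of the z_k and the z_k
   themselves. *)
set q := \prod_k _; set p := \prod_k _; have [pq _|_ /(_ isT)] := eqVneq q p.
  have rootE x : root p x <-> range (z ord0) x := root_prod_XsubC_range _ x.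
  have rootJ x : root p x <-> range (fun k => (z ord0 k)^*) x.
    by rewrite -pq; exact: root_prod_XsubC_range.
  rewrite image_comp; apply/seteqP; split=> x.
    by move=> ?; apply/rootE/rootJ.
  by move=> ?; apply/rootJ/rootE.
move=> [w [w_equi zw wz]]; case: wz => k.
have wE i : (\row_k w k : 'rV[R[i]]_m) i = w by apply/funext => l; rewrite mxE.
(* Otherwise the perturbed configuration lies in the isolating neighbourhood [V], hence is z, a
   contradiction. *)
have : [set z] (\row_k w k).
  rewrite -VE; split; last by rewrite /equilibrium_configurations /= wE.
  by apply: eV; split=> // i l; rewrite mxE ord1; exact: zw.
by move=> /= <-; rewrite mxE.
Qed.
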